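(* Let $k$ be a field and let $\mathcal K = D_b(k)\oplus D_b(k)$, with the cyclic group $C_2$ of order two acting on $\mathcal K$ by permuting the two components. Then the crossed product category $\mathcal K\rtimes C_2$ contains no completely prime thick $\otimes$-ideals. Moreover, the inclusion $F\colon \mathcal K\hookrightarrow \mathcal K\rtimes C_2$, $x\mapsto x\boxtimes 1_{C_2}$, induces neither a well-defined map $\operatorname{Spc}(F)\colon \operatorname{Spc}(\mathcal K\rtimes C_2)\to\operatorname{Spc}(\mathcal K)$, $\mathcal Q\mapsto F^{-1}(\mathcal Q)$ (that is, there is a prime thick $\otimes$-ideal $\mathcal Q$ of $\mathcal K\rtimes C_2$ for which $F^{-1}(\mathcal Q)$ is not prime), nor a well-defined functor $\mathcal S(F)\colon \mathcal S(\mathcal K\rtimes C_2)\to\mathcal S(\mathcal K)$, $(Y,\sigma)\mapsto (Y,\sigma\circ F)$ (that is, there is a support datum $(Y,\sigma)$ for $\mathcal K\rtimes C_2$ for which $(Y,\sigma\circ F)$ is not a support datum for $\mathcal K$).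
   Context: A monoidal triangulated category $\mathcal K$ is a monoidal category (tensor product $\otimes$, unit $\mathbf 1$) which is triangulated (shift $\Sigma$) and for which $\otimes$ is an exact bifunctor; all are assumed essentially small. A thick subcategory is a full triangulated subcategory closed under direct summands (hence under isomorphism). A thick $\otimes$-ideal (two-sided) is a thick subcategory closed under left and right tensoring with arbitrary objects of $\mathcal K$. A proper thick $\otimes$-ideal $\mathcal P$ is prime if for all objects $x,y$: ($x\otimes z\otimes y\in\mathcal P$ for all $z\in\mathcal K$) implies $x\in\mathcal P$ or $y\in\mathcal P$. A proper thick $\otimes$-ideal $\mathcal P$ is completely prime if $x\otimes y\in\mathcal P$ implies $x\in\mathcal P$ or $y\in\mathcal P$. $\operatorname{Spc}(\mathcal K)$ is the set of prime thick $\otimes$-ideals. A support datum for $\mathcal K$ is a topological space $Y$ together with a map $\sigma$ from the objects of $\mathcal K$ to closed subsets of $Y$ such that: (a) $\sigma(0)=\emptyset$, $\sigma(\mathbf 1)=Y$; (b) $\sigma(x\oplus y)=\sigma(x)\cup\sigma(y)$; (c) $\sigma(\Sigma x)=\sigma(x)$; (d) $\sigma(x)\subseteq\sigma(y)\cup\sigma(z)$ for every distinguished triangle $x\to y\to z\to\Sigma x$; (e) $\bigcup_{z\in\mathcal K}\sigma(x\otimes z\otimes y)=\sigma(x)\cap\sigma(y)$. A morphism $(Y,\sigma)\to(Z,\tau)$ is a continuous map $f\colon Y\to Z$ with $f^{-1}(\tau(x))=\sigma(x)$ for all $x$. $\mathcal S(\mathcal K)$ is the category of support data for $\mathcal K$.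 $D_b(k)$ is the bounded derived category of finite-dimensional $k$-vector spaces, and $D_b(k)\oplus D_b(k)$ has componentwise triangulated and tensor structure. If a group $G$ acts on $\mathcal K$ by monoidal triangulated autoequivalences, $x\mapsto {}^gx$, the crossed product category $\mathcal K\rtimes G$ is the direct sum $\bigoplus_{g\in G}\mathcal K$ of additive (triangulated) categories; the object $x\in\mathcal K$ placed in the $g$-component is written $x\boxtimes g$, with $\operatorname{Hom}(x\boxtimes g,y\boxtimes h)=\operatorname{Hom}_{\mathcal K}(x,y)$ if $g=h$ and $0$ otherwise. The tensor product is determined by $(x\boxtimes g)\otimes(y\boxtimes h)=(x\otimes{}^gy)\boxtimes gh$, and the unit is $\mathbf 1\boxtimes 1_G$. *)

(* Defs.v *)
From HB Require Import structures.
From mathcomp Require Import all_boot all_order all_algebra all_fingroup.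
From mathcomp Require Import zify mxtens.
From mathcomp Require Import boolp classical_sets topology_structure.

Set Implicit Arguments.
Unset Strict Implicit.
Unset Printing Implicit Defensive.

Import GRing.Theory.

(** * Monoidal triangulated categories *)

(** The data of a monoidal triangulated category that enters the definitions
    of thick tensor ideals and of support data.  Equality of morphisms is the
    relation [heq], and composition is written in diagrammatic order.  None of
    these definitions appeals to the axioms of a monoidal triangulated
    category, nor to the action of the tensor product on morphisms, so these
    are not recorded; the categories of interest are built explicitly below. *)
Record mtcat : Type := MTCat {
  ob : Type;
  hom : ob -> ob -> Type;
  heq : forall x y, hom x y -> hom x y -> Prop;
  idm : forall x, hom x x;
  comp : forall x y z, hom x y -> hom y z -> hom x z;
  ob0 : ob;
  oplus : ob -> ob -> ob;
  shift : ob -> ob;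
  shiftm : forall x y, hom x y -> hom (shift x) (shift y);
  dist : forall x y z, hom x y -> hom y z -> hom z (shift x) -> Prop;
  tens : ob -> ob -> ob;
  one : ob }.

Arguments ob0 {m}.
Arguments one {m}.

Section Ideals.
Local Open Scope classical_set_scope.
Variable K : mtcat.
Implicit Types (x y z : ob K) (P Q : set (ob K)).

Definition isom x y : Prop :=
  exists (f : hom x y) (g : hom y x),
    heq (comp f g) (idm x) /\ heq (comp g f) (idm y).

(** Full subcategories are identified with their sets of objects. *)
Record thick P : Prop := Thick {
  thick0 : P ob0;
  thick_isom : forall x y, isom x y -> P x -> P y;
  thick_shift : forall x, P (shift x) <-> P x;
  thick_dist : forall x y z (f : hom x y) (g : hom y z) (h : hom z (shift x)),
    dist f g h ->
    [/\ P x -> P y -> P z, P y -> P z -> P x & P x -> P z -> P y];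
  thick_summand : forall x y, P (oplus x y) -> P x /\ P y }.

Record thick_ideal P : Prop := ThickIdeal {
  ideal_thick : thick P;
  ideal_tensl : forall x y, P y -> P (tens x y);
  ideal_tensr : forall x y, P x -> P (tens x y) }.

Definition proper_thick_ideal P : Prop := thick_ideal P /\ exists x, ~ P x.

Definition prime_ideal P : Prop :=
  proper_thick_ideal P /\
  forall x y, (forall z, P (tens (tens x z) y)) -> P x \/ P y.

Definition completely_prime_ideal P : Prop :=
  proper_thick_ideal P /\ forall x y, P (tens x y) -> P x \/ P y.

Definition Spc : set (set (ob K)) := [set P | prime_ideal P].

Record support_datum (Y : topologicalType) (sigma : ob K -> set Y) : Prop :=
  SupportDatum {
    supp_closed : forall x, closed (sigma x);
    supp0 : sigma ob0 = set0;
    supp1 : sigma one = setT;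
    supp_oplus : forall x y, sigma (oplus x y) = sigma x `|` sigma y;
    supp_shift : forall x, sigma (shift x) = sigma x;
    supp_dist :
      forall x y z (f : hom x y) (g : hom y z) (h : hom z (shift x)),
      dist f g h -> sigma x `<=` sigma y `|` sigma z;
    supp_tens : forall x y,
      \bigcup_z sigma (tens (tens x z) y) = sigma x `&` sigma y }.

End Ideals.

Arguments Spc : clear implicits.

(** * The direct sum of two categories *)

Definition mtprod (K L : mtcat) : mtcat := {|
  ob := ob K * ob L;
  hom x y := (hom x.1 y.1 * hom x.2 y.2)%type;
  heq x y f g := heq f.1 g.1 /\ heq f.2 g.2;
  idm x := (idm x.1, idm x.2);
  comp x y z f g := (comp f.1 g.1, comp f.2 g.2);
  ob0 := (ob0, ob0);
  oplus x y := (oplus x.1 y.1, oplus x.2 y.2);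
  shift x := (shift x.1, shift x.2);
  shiftm x y f := (shiftm f.1, shiftm f.2);
  dist x y z f g h := dist f.1 g.1 h.1 /\ dist f.2 g.2 h.2;
  tens x y := (tens x.1 y.1, tens x.2 y.2);
  one := (one, one) |}.

(** * Crossed products *)

Section CrossedProduct.
Local Open Scope group_scope.
Variables (G : finGroupType) (K : mtcat) (act : G -> ob K -> ob K).

(** The object [x] placed in the [g]-component. *)
Definition box (x : ob K) (g : G) : G -> ob K :=
  fun h => if h == g then x else ob0.

(** As [G] is finite, an object of the direct sum of copies of [K] indexed by
    [G] is an arbitrary family [x], standing for the sum of the [box (x g) g].
    The tensor product is the biadditive extension of
    [box x g * box y h = box (x * act g y) (g * h)], with components indexed by
    [g] and [g^-1 * k] contributing to the component indexed by [k]. *)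
Definition crossed : mtcat := {|
  ob := G -> ob K;
  hom x y := forall g, hom (x g) (y g);
  heq x y f f' := forall g, heq (f g) (f' g);
  idm x := fun g => idm (x g);
  comp x y z f f' := fun g => comp (f g) (f' g);
  ob0 := fun=> ob0;
  oplus x y := fun g => oplus (x g) (y g);
  shift x := fun g => shift (x g);
  shiftm x y f := fun g => shiftm (f g);
  dist x y z f f' f'' := forall g, dist (f g) (f' g) (f'' g);
  tens x y := fun k =>
    \big[@oplus K/ob0]_(g : G) tens (x g) (act g (y (g^-1 * k)));
  one := box one 1 |}.

End CrossedProduct.

(** * The bounded derived category of finite-dimensional vector spaces *)

Local Open Scope ring_scope.

Section BoundedComplexes.
Variable k : fieldType.

(** The matrix [A] is homogeneous of degree [r] when the basis vectors of its
    source and target have degrees [a] and [b]; matrices act on row vectors. *)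
Definition graded m n (a : 'rV[int]_m) (b : 'rV[int]_n) (r : int)
    (A : 'M[k]_(m, n)) : Prop :=
  forall i j, A i j != 0 -> b 0 j = a 0 i + r.

(** A bounded cochain complex of finite-dimensional vector spaces, given by
    the matrix of the total differential in a finite homogeneous basis: the
    term of degree [n] is the span of the basis vectors of degree [n].  Every
    bounded complex of finite-dimensional spaces has such a basis, and the
    basis plays no role in the morphisms below. *)
Record bcomplex : Type := BComplex {
  cdim : nat;
  cdeg : 'rV[int]_cdim;
  cdiff : 'M[k]_cdim;
  cdiff_graded : graded cdeg cdeg 1 cdiff;
  cdiff_sq : cdiff *m cdiff = 0 }.

Record cmap (X Y : bcomplex) : Type := CMap {
  cmat :> 'M[k]_(cdim X, cdim Y);
  cmat_graded : graded (cdeg X) (cdeg Y) 0 cmat;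
  cmat_comm : cmat *m cdiff Y = cdiff X *m cmat }.

Definition homog (X : bcomplex) (n : int) (v : 'rV[k]_(cdim X)) : Prop :=
  forall i, v 0 i != 0 -> cdeg X 0 i = n.

Definition cocycle (X : bcomplex) (n : int) (v : 'rV[k]_(cdim X)) : Prop :=
  homog n v /\ v *m cdiff X = 0.

Definition coboundary (X : bcomplex) (n : int) (v : 'rV[k]_(cdim X)) : Prop :=
  exists2 u, homog (n - 1) u & v = u *m cdiff X.

(** [H^n(f)] is injective and surjective for every [n]. *)
Definition quasi_iso (X Y : bcomplex) (f : cmap X Y) : Prop :=
  forall n : int,
    (forall v, cocycle n v -> coboundary n (v *m f) -> coboundary n v) /\
    (forall w, cocycle n w ->
       exists2 v, cocycle n v & coboundary n (w - v *m f)).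

Fact graded0 m n (a : 'rV_m) (b : 'rV_n) r : graded a b r 0.
Proof. by move=> i j; rewrite mxE eqxx. Qed.

Fact graded1 n (a : 'rV_n) : graded a a 0 1%:M.
Proof. by move=> i j; rewrite mxE; case: (i =P j) => [->|]; rewrite ?addr0 ?eqxx. Qed.

Fact gradedN m n (a : 'rV_m) (b : 'rV_n) r A :
  graded a b r A -> graded a b r (- A).
Proof. by move=> h i j; rewrite mxE oppr_eq0; apply: h. Qed.

Fact gradedD m n (a : 'rV_m) (b : 'rV_n) r A B :
  graded a b r A -> graded a b r B -> graded a b r (A + B).
Proof.
move=> hA hB i j; rewrite mxE; have [->|/hA //] := eqVneq (A i j) 0.
by rewrite add0r; apply: hB.
Qed.

Fact gradedM m n p (a : 'rV_m) (b : 'rV_n) (c : 'rV_p) r s A B :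
  graded a b r A -> graded b c s B -> graded a c (r + s) (A *m B).
Proof.
move=> hA hB i j nz; suff /existsP[l] : [exists l, A i l * B l j != 0].
  by rewrite mulf_eq0 negb_or => /andP[/hA eb /hB ->]; rewrite eb addrA.
apply: contraNT nz => /existsPn z; rewrite mxE big1 // => l _.
by apply/eqP; rewrite -[_ == _]negbK z.
Qed.

Fact graded_block m1 m2 n1 n2 (a1 : 'rV_m1) (a2 : 'rV_m2) (b1 : 'rV_n1)
    (b2 : 'rV_n2) r A B C D :
  graded a1 b1 r A -> graded a1 b2 r B -> graded a2 b1 r C ->
  graded a2 b2 r D -> graded (row_mx a1 a2) (row_mx b1 b2) r (block_mx A B C D).
Proof.
move=> hA hB hC hD i j; rewrite -(splitK i) -(splitK j).
case: (split i) (split j) => {}i [] {}j /=.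
- by rewrite block_mxEul !row_mxEl; apply: hA.
- by rewrite block_mxEur row_mxEl row_mxEr; apply: hB.
- by rewrite block_mxEdl row_mxEl row_mxEr; apply: hC.
- by rewrite block_mxEdr !row_mxEr; apply: hD.
Qed.

Fact graded_shift m n (a : 'rV_m) (b : 'rV_n) r s A :
  graded a b r A -> graded (a - const_mx s) (b - const_mx s) r A.
Proof. by move=> h i j /h; rewrite !mxE => ->; rewrite addrAC. Qed.

Section Identity.
Variable X : bcomplex.

Fact cid_comm : 1%:M *m cdiff X = cdiff X *m 1%:M.
Proof. by rewrite mul1mx mulmx1. Qed.

Definition cid : cmap X X := CMap (@graded1 _ _) cid_comm.
End Identity.

Section Composition.
Variables (X Y Z : bcomplex) (f : cmap X Y) (g : cmap Y Z).

Fact ccomp_comm : (f *m g) *m cdiff Z = cdiff X *m (f *m g).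
Proof. by rewrite -mulmxA cmat_comm !mulmxA cmat_comm. Qed.

Definition ccomp : cmap X Z :=
  CMap (gradedM (@cmat_graded _ _ f) (@cmat_graded _ _ g)) ccomp_comm.
End Composition.

(** ** The derived category *)

(** [D_b(k)] is the localization of the category of bounded complexes at the
    quasi-isomorphisms: its morphisms are formal composites of chain maps and
    of inverses of quasi-isomorphisms, modulo the smallest congruence [deq]
    which makes [dmap] a functor and makes [dinv f] inverse to [dmap f]. *)
Inductive dhom : bcomplex -> bcomplex -> Type :=
| dmap X Y (f : cmap X Y) : dhom X Y
| dinv X Y (f : cmap X Y) (qf : quasi_iso f) : dhom Y X
| dcomp X Y Z (a : dhom X Y) (b : dhom Y Z) : dhom X Z.

Inductive deq : forall X Y, dhom X Y -> dhom X Y -> Prop :=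
| deq_refl X Y (a : dhom X Y) : deq a a
| deq_sym X Y (a b : dhom X Y) : deq a b -> deq b a
| deq_trans X Y (a b c : dhom X Y) : deq a b -> deq b c -> deq a c
| deq_comp X Y Z (a a' : dhom X Y) (b b' : dhom Y Z) :
    deq a a' -> deq b b' -> deq (dcomp a b) (dcomp a' b')
| deq_assoc X Y Z T (a : dhom X Y) (b : dhom Y Z) (c : dhom Z T) :
    deq (dcomp a (dcomp b c)) (dcomp (dcomp a b) c)
| deq_idl X Y (a : dhom X Y) : deq (dcomp (dmap (cid X)) a) a
| deq_idr X Y (a : dhom X Y) : deq (dcomp a (dmap (cid Y))) a
| deq_ext X Y (f g : cmap X Y) :
    cmat f = cmat g -> deq (dmap f) (dmap g)
| deq_map X Y Z (f : cmap X Y) (g : cmap Y Z) :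
    deq (dmap (ccomp f g)) (dcomp (dmap f) (dmap g))
| deq_invr X Y (f : cmap X Y) (qf : quasi_iso f) :
    deq (dcomp (dmap f) (dinv qf)) (dmap (cid X))
| deq_invl X Y (f : cmap X Y) (qf : quasi_iso f) :
    deq (dcomp (dinv qf) (dmap f)) (dmap (cid Y)).

(** ** Zero object and direct sums *)

Definition czero : bcomplex :=
  BComplex (@graded0 0 0 0 0 1) (mulmx0 _ 0).

Section DirectSum.
Variables X Y : bcomplex.

Fact cdsum_sq :
  block_mx (cdiff X) 0 0 (cdiff Y) *m block_mx (cdiff X) 0 0 (cdiff Y) = 0.
Proof.
by rewrite mulmx_block !cdiff_sq !mulmx0 !mul0mx !addr0 block_mx0.
Qed.

Definition cdsum : bcomplex :=
  BComplex (graded_block (@cdiff_graded X) (@graded0 _ _ _ _ _)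
              (@graded0 _ _ _ _ _) (@cdiff_graded Y)) cdsum_sq.
End DirectSum.

(** ** The shift: [(cshift X)^n = X^(n+1)], with differential [- d] *)

Section Shift.
Variable X : bcomplex.

Fact cshift_sq : - cdiff X *m - cdiff X = 0.
Proof. by rewrite mulmxN mulNmx cdiff_sq !oppr0. Qed.

Definition cshift : bcomplex :=
  BComplex (graded_shift 1 (gradedN (@cdiff_graded X))) cshift_sq.

Lemma cshift_homog n v : @homog cshift n v <-> @homog X (n + 1) v.
Proof.
have e i : cdeg cshift 0 i = cdeg X 0 i - 1 by rewrite !mxE.
split=> h i /h; first by rewrite e => <-; rewrite subrK.
by rewrite e => ->; rewrite addrK.
Qed.

Lemma cshift_cocycle n v : @cocycle cshift n v <-> @cocycle X (n + 1) v.
Proof.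
split=> -[/cshift_homog hv] /eqP dv; split=> //; apply/eqP.
  by move: dv; rewrite mulmxN oppr_eq0.
by rewrite mulmxN oppr_eq0.
Qed.

Lemma cshift_coboundary n v :
  @coboundary cshift n v <-> @coboundary X (n + 1) v.
Proof.
have homogN (Z : bcomplex) m (u : 'rV_(cdim Z)) : homog m u -> homog m (- u).
  by move=> h i; rewrite mxE oppr_eq0; apply: h.
split=> -[u hu ->]; exists (- u).
- by move/homogN/cshift_homog: hu; rewrite addrAC.
- by rewrite mulmxN mulNmx.
- by apply/homogN/cshift_homog; rewrite addrAC.
- by rewrite mulmxN mulNmx opprK.
Qed.
End Shift.

Section ShiftMap.
Variables (X Y : bcomplex) (f : cmap X Y).

Fact cshiftm_comm : f *m - cdiff Y = - cdiff X *m f.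
Proof. by rewrite mulmxN mulNmx cmat_comm. Qed.

Definition cshiftm : cmap (cshift X) (cshift Y) :=
  @CMap (cshift X) (cshift Y) f (graded_shift 1 (@cmat_graded _ _ f)) cshiftm_comm.

Fact cshiftm_quasi_iso : quasi_iso f -> quasi_iso cshiftm.
Proof.
move=> qf n; have [inj surj] := qf (n + 1); split=> [v|w] /cshift_cocycle cv.
  by move=> /cshift_coboundary bv; apply/cshift_coboundary; apply: inj.
have [v cv' bv] := surj w cv.
by exists v; [apply/cshift_cocycle|apply/cshift_coboundary].
Qed.
End ShiftMap.

Fixpoint dshiftm X Y (a : dhom X Y) : dhom (cshift X) (cshift Y) :=
  match a with
  | dmap _ _ f => dmap (cshiftm f)
  | dinv _ _ _ qf => dinv (cshiftm_quasi_iso qf)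
  | dcomp _ _ _ a b => dcomp (dshiftm a) (dshiftm b)
  end.

(** ** Distinguished triangles *)

Section Cone.
Variables (X Y : bcomplex) (f : cmap X Y).

Definition cone_diff : 'M[k]_(cdim X + cdim Y) :=
  block_mx (- cdiff X) f 0 (cdiff Y).

Fact cone_diff_graded :
  graded (row_mx (cdeg X - const_mx 1) (cdeg Y))
         (row_mx (cdeg X - const_mx 1) (cdeg Y)) 1 cone_diff.
Proof.
apply: graded_block.
- exact: (@cdiff_graded (cshift X)).
- by move=> i j /cmat_graded; rewrite !mxE addr0 subrK.
- exact: graded0.
- exact: cdiff_graded.
Qed.

Fact cone_diff_sq : cone_diff *m cone_diff = 0.
Proof.
rewrite mulmx_block mulmxN !mulNmx cmat_comm !cdiff_sq !mulmx0 !mul0mx.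
by rewrite ?addr0 ?add0r ?oppr0 addNr block_mx0.
Qed.

(** [cone^n = X^(n+1) (+) Y^n], with [d (x, y) = (- d x, f x + d y)]. *)
Definition cone : bcomplex := BComplex cone_diff_graded cone_diff_sq.

Definition cone_in_mat : 'M[k]_(cdim Y, cdim cone) := row_mx 0 1%:M.
Definition cone_out_mat : 'M[k]_(cdim cone, cdim (cshift X)) := col_mx 1%:M 0.

Fact cone_in_graded : graded (cdeg Y) (cdeg cone) 0 cone_in_mat.
Proof.
move=> i j; rewrite -(splitK j); case: (split j) => {}j /=.
  by rewrite /cone_in_mat [row_mx 0 _ i _]row_mxEl mxE eqxx.
by rewrite /cone_in_mat !row_mxEr => /graded1 ->.
Qed.

Fact cone_in_comm : cone_in_mat *m cdiff cone = cdiff Y *m cone_in_mat.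
Proof.
by rewrite mul_row_block mul_mx_row !mul0mx !mulmx0 ?add0r mul1mx mulmx1.
Qed.

Fact cone_out_graded : graded (cdeg cone) (cdeg (cshift X)) 0 cone_out_mat.
Proof.
move=> i j; rewrite -(splitK i); case: (split i) => {}i /=.
  by rewrite /cone_out_mat col_mxEu row_mxEl => /(@graded1 _ (cdeg (cshift X))).
by rewrite /cone_out_mat col_mxEd mxE eqxx.
Qed.

Fact cone_out_comm :
  cone_out_mat *m cdiff (cshift X) = cdiff cone *m cone_out_mat.
Proof.
by rewrite mul_col_mx mul_block_col !mulmx0 !mul0mx ?addr0 mul1mx mulmx1.
Qed.

Definition cone_in : cmap Y cone := CMap cone_in_graded cone_in_comm.
Definition cone_out : cmap cone (cshift X) :=
  CMap cone_out_graded cone_out_comm.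
End Cone.

(** Isomorphisms are described by mutually inverse pairs [a, a'] etc. *)
Definition ddist X Y Z (u : dhom X Y) (v : dhom Y Z) (w : dhom Z (cshift X)) :
    Prop :=
  exists (A B : bcomplex) (f : cmap A B)
         (a : dhom X A) (a' : dhom A X) (b : dhom Y B) (b' : dhom B Y)
         (c : dhom Z (cone f)) (c' : dhom (cone f) Z),
  [/\ deq (dcomp a a') (dmap (cid X)) /\ deq (dcomp a' a) (dmap (cid A)),
      deq (dcomp b b') (dmap (cid Y)) /\ deq (dcomp b' b) (dmap (cid B)) &
      deq (dcomp c c') (dmap (cid Z)) /\ deq (dcomp c' c) (dmap (cid (cone f)))]
  /\
  [/\ deq (dcomp u b) (dcomp a (dmap f)),
      deq (dcomp v c) (dcomp b (dmap (cone_in f))) &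
      deq (dcomp w (dshiftm a)) (dcomp c (dmap (cone_out f)))].

(** ** Tensor products: [d (x * y) = d x * y + (-1)^|x| x * d y] *)

Section Tensor.
Variables X Y : bcomplex.

(** [mxtens_index] enumerates the basis of pairs of basis vectors, and [*t] is
    the Kronecker product with respect to it. *)
Definition ctens_deg : 'rV[int]_(cdim X * cdim Y) :=
  \row_l (cdeg X 0 (mxtens_unindex l).1 + cdeg Y 0 (mxtens_unindex l).2).

Definition sign_mx : 'M[k]_(cdim X) :=
  diag_mx (\row_i (-1) ^+ `|cdeg X 0%R i|%N).

Definition ctens_diff : 'M[k]_(cdim X * cdim Y) :=
  cdiff X *t 1%:M + sign_mx *t cdiff Y.

Fact graded_tens r s A B :
  graded (cdeg X) (cdeg X) r A -> graded (cdeg Y) (cdeg Y) s B ->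
  graded ctens_deg ctens_deg (r + s) (A *t B).
Proof.
move=> hA hB i j; rewrite !mxE mulf_eq0 negb_or => /andP[/hA -> /hB ->].
by rewrite addrACA.
Qed.

Fact sign_graded : graded (cdeg X) (cdeg X) 0 sign_mx.
Proof.
move=> i j; rewrite !mxE; case: (i =P j) => [->|_]; first by rewrite addr0.
by rewrite eqxx.
Qed.

Fact ctens_diff_graded : graded ctens_deg ctens_deg 1 ctens_diff.
Proof.
apply: gradedD; first exact: (graded_tens (@cdiff_graded X) (@graded1 _ _)).
exact: (graded_tens sign_graded (@cdiff_graded Y)).
Qed.

Fact sign_cdiff : cdiff X *m sign_mx = - (sign_mx *m cdiff X).
Proof.
apply/matrixP => i j; rewrite mul_mx_diag mul_diag_mx !mxE.
have [->|/cdiff_graded ->] := eqVneq (cdiff X i j) 0.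
  by rewrite mul0r mulr0 oppr0.
have [->|->] : `|(cdeg X 0 i + 1)%R|%N = `|cdeg X 0%R i|%N.+1 \/
               `|cdeg X 0%R i|%N = `|(cdeg X 0 i + 1)%R|%N.+1 by lia.
  by rewrite exprS mulN1r mulrN mulrC.
by rewrite exprS mulN1r mulNr opprK mulrC.
Qed.

Fact ctens_diff_sq : ctens_diff *m ctens_diff = 0.
Proof.
rewrite mulmxDl !mulmxDr !tensmx_mul !cdiff_sq tens0mx tensmx0 add0r addr0.
rewrite mul1mx mulmx1 sign_cdiff.
by apply/matrixP => i j; rewrite !mxE mulNr addNr.
Qed.

Definition ctens : bcomplex := BComplex ctens_diff_graded ctens_diff_sq.
End Tensor.

Definition cunit : bcomplex :=
  BComplex (@graded0 1 1 0 0 1) (mulmx0 _ 0).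

End BoundedComplexes.

Definition Db (k : fieldType) : mtcat := {|
  ob := bcomplex k;
  hom := @dhom k;
  heq := @deq k;
  idm X := dmap (cid X);
  comp := @dcomp k;
  ob0 := czero k;
  oplus := @cdsum k;
  shift := @cshift k;
  shiftm := @dshiftm k;
  dist := @ddist k;
  tens := @ctens k;
  one := cunit k |}.

(** * The crossed product of [Db k (+) Db k] with the swap action of [C_2] *)

Definition Db2 (k : fieldType) : mtcat := mtprod (Db k) (Db k).

(** ['Z_2] is used as a group through its addition. *)
Definition swap_act (k : fieldType) (g : 'Z_2) (x : ob (Db2 k)) : ob (Db2 k) :=
  if g == 1%g then x else (x.2, x.1).

Definition Db2C2 (k : fieldType) : mtcat := crossed (@swap_act k).

Definition incl (k : fieldType) (x : ob (Db2 k)) : ob (Db2C2 k) :=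
  box x (1%g : 'Z_2).

(* Main.v *)
Require Import Defs.
From mathcomp Require Import all_boot all_order all_algebra.
From mathcomp Require Import boolp classical_sets topology_structure topology.
From mathcomp Require Import mxtens zify.

(** Call an object of the crossed product vanishing when all four of its
    component complexes are exact.  Since a complex over a field splits, a tensor
    product of complexes is exact only if one of the factors is; as tensoring with
    objects of all degrees of [C_2] moves any component to any other, the vanishing
    objects form a prime ideal, and sending them to the empty set and every other
    object to the whole space is a support datum.  In [Db k (+) Db k], however,
    [(1, 0) * z * (0, 1) = 0] for every [z].

    If [P] is a completely prime ideal and [g] generates [C_2], then the object
    [E = box (1, 0) g] has [E * E = 0], so [E] is in [P].  Tensoring [E] with
    [box (1, 1) g] on either side puts [box (1, 0) 1] and [box (0, 1) 1] in [P].  Their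
    products with an arbitrary object [x] are two complementary pieces of [x],
    which a triangle glues back to [x], so [P] is not proper. *)

Set Implicit Arguments.
Unset Strict Implicit.
Unset Printing Implicit Defensive.

Import GRing.Theory.
Local Open Scope ring_scope.

(** * Exact complexes *)

Section GradedPart.
Variable k : fieldType.

(** Matrix algebra such as [pinvmx] ignores degrees. Its solutions are made homogeneous by
    projecting onto one degree, which keeps the equations they satisfy. *)
Definition graded_part m n (a : 'rV[int]_m) (b : 'rV[int]_n) (r : int)
    (A : 'M[k]_(m, n)) : 'M[k]_(m, n) :=
  \matrix_(i, j) if b 0 j == a 0 i + r then A i j else 0.

Lemma graded_part_graded m n (a : 'rV_m) (b : 'rV_n) r A :
  graded a b r (graded_part a b r A).
Proof. by move=> i j; rewrite mxE; case: ifP => [/eqP|]; rewrite ?eqxx. Qed.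

Lemma graded_part_id m n (a : 'rV_m) (b : 'rV_n) r A :
  graded a b r A -> graded_part a b r A = A.
Proof.
move=> hA; apply/matrixP => i j; rewrite mxE; case: eqP => // ne.
by apply/esym/eqP; apply: contra_notT ne; apply: hA.
Qed.

Lemma graded_partD m n (a : 'rV_m) (b : 'rV_n) r A B :
  graded_part a b r (A + B) = graded_part a b r A + graded_part a b r B.
Proof. by apply/matrixP => i j; rewrite !mxE; case: ifP; rewrite ?addr0. Qed.

(** A homogeneous factor moves every entry by the same degree, so the projection passes to the other
    factor. The separate [t] allows total degrees such as [0 = 1 + -1]. *)
Lemma graded_partMl m n p (a : 'rV_m) (b : 'rV_n) (c : 'rV_p) r s t A B :
  t = r + s -> graded a b r A ->
  graded_part a c t (A *m B) = A *m graded_part b c s B.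
Proof.
move=> -> hA; apply/matrixP => i j; rewrite !mxE.
have [e|ne] := eqVneq.
  apply: eq_bigr => l _; rewrite mxE; have [->|/hA h] := eqVneq (A i l) 0.
    by rewrite !mul0r.
  by rewrite h -addrA e eqxx.
rewrite big1 // => l _; rewrite mxE; have [->|/hA h] := eqVneq (A i l) 0.
  by rewrite mul0r.
by rewrite h -addrA (negPf ne) mulr0.
Qed.

Lemma graded_partMr m n p (a : 'rV_m) (b : 'rV_n) (c : 'rV_p) r s t A B :
  t = r + s -> graded b c s B ->
  graded_part a c t (A *m B) = graded_part a b r A *m B.
Proof.
move=> -> hB; apply/matrixP => i j; rewrite !mxE.
have [e|ne] := eqVneq.
  apply: eq_bigr => l _; rewrite mxE; have [->|/hB h] := eqVneq (B l j) 0.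
    by rewrite !mulr0.
  by move/eqP: e; rewrite h addrA (inj_eq (addIr _)) => ->.
rewrite big1 // => l _; rewrite mxE; have [->|/hB h] := eqVneq (B l j) 0.
  by rewrite mulr0.
by move: ne; rewrite h addrA (inj_eq (addIr _)) => /negPf ->; rewrite mul0r.
Qed.

Lemma homog_graded (X : bcomplex k) n v :
  @homog k X n v <-> graded (0 : 'rV_1) (cdeg X) n v.
Proof.
split=> h; first by move=> i j; rewrite ord1 mxE add0r; apply: h.
by move=> i /h; rewrite mxE add0r.
Qed.

Lemma homogM (X Y : bcomplex k) n r (A : 'M_(cdim X, cdim Y)) v :
  graded (cdeg X) (cdeg Y) r A -> @homog k X n v -> @homog k Y (n + r) (v *m A).
Proof. by move=> hA /homog_graded hv; apply/homog_graded/(gradedM hv). Qed.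

Lemma homogB (X : bcomplex k) n v w :
  @homog k X n v -> @homog k X n w -> @homog k X n (v - w).
Proof.
move=> /homog_graded hv /homog_graded hw; apply/homog_graded.
by apply: gradedD => //; apply: gradedN.
Qed.

Lemma homogD (X : bcomplex k) n v w :
  @homog k X n v -> @homog k X n w -> @homog k X n (v + w).
Proof.
by move=> /homog_graded hv /homog_graded hw; apply/homog_graded/gradedD.
Qed.

End GradedPart.

(** * Contractions, shifts, sums and cones *)

Section Exactness.
Variable k : fieldType.
Implicit Types X Y Z : bcomplex k.

(** Exactness of the total differential, with no reference to degrees; [exact_acyclic] compares it
    with the vanishing of every cohomology group. *)
Definition exact X : Prop := forall v : 'rV_(cdim X),
  v *m cdiff X = 0 -> exists u, v = u *m cdiff X.

Lemma coboundary_homog X n (v u : 'rV_(cdim X)) :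
  homog n v -> v = u *m cdiff X -> coboundary n v.
Proof.
move=> /homog_graded hv e; exists (graded_part 0 (cdeg X) (n - 1) u).
  exact/homog_graded/graded_part_graded.
rewrite -[LHS](graded_part_id hv) e.
by rewrite (graded_partMr (r := n - 1) _ _ _ (@cdiff_graded _ X)) // subrK.
Qed.

(** Writing [d] for the differential, [h = q d p] satisfies [d h = d p] and [h d = q d], because
    [d d = 0]. The identity has degree 0 and [d] degree 1, so the part of [h] of degree -1 satisfies
    the same equation. *)
Lemma contraction_of_splitting X (p q : 'M_(cdim X)) :
  cdiff X *m p + q *m cdiff X = 1%:M ->
  exists2 h, graded (cdeg X) (cdeg X) (- 1) h &
    cdiff X *m h + h *m cdiff X = 1%:M.
Proof.
move=> e; pose h := q *m cdiff X *m p.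
have e1 : q *m cdiff X = 1%:M - cdiff X *m p by rewrite -e addrAC subrr add0r.
have e2 : cdiff X *m p = 1%:M - q *m cdiff X by rewrite -e addrK.
have eh : cdiff X *m h + h *m cdiff X = 1%:M.
  rewrite {1}/h e1 mulmxBl mul1mx mulmxBr !mulmxA cdiff_sq !mul0mx subr0.
  rewrite -mulmxA -mulmxA [X in q *m X]mulmxA e2 mulmxBl mul1mx -mulmxA.
  by rewrite cdiff_sq mulmx0 subr0 -{1}e2 e.
exists (graded_part (cdeg X) (cdeg X) (- 1) h).
  exact: graded_part_graded.
rewrite -(graded_partMl (s := -1) (t := 0) _ _ _ (@cdiff_graded _ X)) ?subrr //.
rewrite -(graded_partMr (r := -1) (t := 0) _ _ _ (@cdiff_graded _ X)) ?addNr //.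
by rewrite -graded_partD eh graded_part_id //; apply: graded1.
Qed.

Lemma exact_of_splitting X (p q : 'M_(cdim X)) :
  cdiff X *m p + q *m cdiff X = 1%:M -> exact X.
Proof.
move=> e v dv; exists (v *m q).
by rewrite -mulmxA -[LHS]mulmx1 -e mulmxDr mulmxA dv mul0mx add0r.
Qed.

Lemma exact_rows X m (A : 'M_(m, cdim X)) :
  (forall i, exists u, row i A = u *m cdiff X) -> exists q, A = q *m cdiff X.
Proof.
move=> h; apply/submxP/row_subP => i; have [u ->] := h i; exact: submxMl.
Qed.

(** Over a field [p = pinvmx d] satisfies [d p d = d]. The rows of [1 - d p] are then killed by [d],
    hence are boundaries, and [1 - d p = q d]. *)
Lemma exactP X :
  exact X <-> exists2 h, graded (cdeg X) (cdeg X) (- 1) h &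
    cdiff X *m h + h *m cdiff X = 1%:M.
Proof.
split=> [ex|[h _ eh]]; last exact: exact_of_splitting eh.
have /exact_rows[q eq] :
  forall i, exists u, row i (1%:M - cdiff X *m pinvmx (cdiff X)) = u *m cdiff X.
  by move=> i; apply: ex; rewrite -row_mul mulmxBl mul1mx mulmxKpV // subrr row0.
by apply: (contraction_of_splitting (p := pinvmx (cdiff X)) (q := q));
  rewrite -eq addrC subrK.
Qed.

Lemma exact_acyclic X :
  exact X <-> forall n v, cocycle n v -> @coboundary k X n v.
Proof.
split=> [ex n v [hv /ex[u e]]|ac]; first exact: coboundary_homog e.
(* Only homogeneous cocycles are known to bound here, so the pseudo-inverse is first cut down to
   degree -1; row [i] of [1 - d p] then has the degree of basis vector [i]. *)
pose p := graded_part (cdeg X) (cdeg X) (- 1) (pinvmx (cdiff X)).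
have ep : cdiff X *m p *m cdiff X = cdiff X.
  rewrite -(graded_partMl (s := -1) (t := 0) _ _ _ (@cdiff_graded _ X)) ?subrr //.
  rewrite -(graded_partMr (r := 0) (t := 1) _ _ _ (@cdiff_graded _ X)) ?add0r //.
  by rewrite mulmxKpV // graded_part_id //; apply: cdiff_graded.
have /exact_rows[q eq] :
    forall i, exists u, row i (1%:M - cdiff X *m p) = u *m cdiff X.
  move=> i; suff [u _ ->] : @coboundary k X (cdeg X 0 i) (row i (1%:M - cdiff X *m p)).
    by exists u.
  apply: ac; split; last by rewrite -row_mul mulmxBl mul1mx ep subrr row0.
  move=> j; rewrite [row i _ 0 j]mxE => nz; rewrite -[RHS]addr0.
  have h : graded (cdeg X) (cdeg X) 0 (1%:M - cdiff X *m p).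
    apply: gradedD; first exact: graded1.
    have hp := @graded_part_graded _ _ _ (cdeg X) (cdeg X) (-1) (pinvmx (cdiff X)).
    by have := gradedN (gradedM (@cdiff_graded _ X) hp); rewrite subrr.
  exact: h.
by apply: (exact_of_splitting (p := p) (q := q)); rewrite -eq addrC subrK.
Qed.

Lemma exact_czero : exact (czero k).
Proof. by move=> v _; exists 0; rewrite [v]thinmx0 mul0mx. Qed.

Lemma exact_cunit : ~ exact (cunit k).
Proof.
move=> /(_ 1%:M); rewrite mulmx0 => /(_ erefl) [u /eqP].
by rewrite mulmx0 oner_eq0.
Qed.

Lemma exact_cshift X : exact (cshift X) <-> exact X.
Proof.
split=> ex v.
  move=> dv; have [|u ->] := ex v; first by rewrite mulmxN dv oppr0.
  by exists (- u); rewrite mulNmx mulmxN.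
rewrite /= mulmxN => /eqP; rewrite oppr_eq0 => /eqP/ex[u ->].
by exists (- u); rewrite mulNmx mulmxN opprK.
Qed.

Lemma exact_cdsum X Y : exact (cdsum X Y) <-> exact X /\ exact Y.
Proof.
split=> [ex|[exX exY] v].
  split=> v dv.
    have [|u] := ex (row_mx v 0).
      by rewrite /= mul_row_block dv !mulmx0 mul0mx !addr0 row_mx0.
    rewrite -[u]hsubmxK /= mul_row_block => /eq_row_mx[-> _].
    by exists (lsubmx u); rewrite mulmx0 addr0.
  have [|u] := ex (row_mx 0 v).
    by rewrite /= mul_row_block dv !mulmx0 mul0mx !addr0 row_mx0.
  rewrite -[u]hsubmxK /= mul_row_block => /eq_row_mx[_ ->].
  by exists (rsubmx u); rewrite mulmx0 add0r.
rewrite -[v]hsubmxK /= mul_row_block !mulmx0 addr0 add0r -row_mx0.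
move=> /eq_row_mx[/exX[a ->] /exY[b ->]]; exists (row_mx a b).
by rewrite mul_row_block !mulmx0 addr0 add0r.
Qed.

Lemma cone_mul X Y (f : cmap X Y) (x : 'rV_(cdim X)) (y : 'rV_(cdim Y)) :
  row_mx x y *m cdiff (cone f) = row_mx (- (x *m cdiff X)) (x *m f + y *m cdiff Y).
Proof. by rewrite /= mul_row_block mulmxN mulmx0 addr0. Qed.

Lemma exact_coneP X Y (f : cmap X Y) :
  exact (cone f) <->
  forall (x : 'rV_(cdim X)) y, x *m cdiff X = 0 -> x *m f + y *m cdiff Y = 0 ->
    exists x' y', x = - (x' *m cdiff X) /\ y = x' *m f + y' *m cdiff Y.
Proof.
split=> [ex x y dx dy|h v].
  have [|u] := ex (row_mx x y); first by rewrite cone_mul dx dy oppr0 row_mx0.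
  rewrite -[u]hsubmxK cone_mul => /eq_row_mx[ex' ey].
  by exists (lsubmx u), (rsubmx u).
rewrite -[v]hsubmxK cone_mul -row_mx0 => /eq_row_mx[/eqP].
rewrite oppr_eq0 => /eqP dx dy; have [x' [y' [-> ->]]] := h _ _ dx dy.
by exists (row_mx x' y'); rewrite cone_mul.
Qed.

(** This is the long exact sequence of the cone, carried out on row vectors through
    [exact_coneP]. *)
Lemma exact_cone X Y (f : cmap X Y) :
  [/\ exact X -> exact Y -> exact (cone f),
      exact Y -> exact (cone f) -> exact X &
      exact X -> exact (cone f) -> exact Y].
Proof.
split=> [exX exY|exY /exact_coneP exC x dx|exX /exact_coneP exC y dy].
- apply/exact_coneP => x y /exX[u ->]; rewrite -mulmxA -cmat_comm mulmxA.
  rewrite -mulmxDl => /exY[w e]; exists (- u), w.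
  by rewrite !mulNmx opprK -e addrA addNr add0r.
- have [|w ew] := exY (x *m f); first by rewrite -mulmxA cmat_comm mulmxA dx mul0mx.
  have [|x' [_ [-> _]]] := exC x (- w) dx; first by rewrite mulNmx ew subrr.
  by exists (- x'); rewrite mulNmx.
- have [||x' [y' [/esym/eqP]]] := exC 0 y; rewrite ?mul0mx ?dy ?addr0 //.
  rewrite oppr_eq0 => /eqP/exX[t ->] ->; exists (t *m f + y').
  by rewrite mulmxDl -!mulmxA cmat_comm.
Qed.

(** Injectivity on cohomology comes from the cone cocycle [(v, -u)], where [v f = u d], and
    surjectivity from [(0, w)]. *)
Lemma quasi_iso_of_cone X Y (f : cmap X Y) : exact (cone f) -> quasi_iso f.
Proof.
move=> /exact_coneP ex n; split=> [v [hv dv] [u _ e]|w [hw dw]].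
  have [|x' [_ [ev _]]] := ex v (- u) dv; first by rewrite mulNmx e subrr.
  by apply: (coboundary_homog (u := - x')); rewrite ?mulNmx.
have [||a [b [/esym/eqP da ew]]] := ex 0 w; rewrite ?mul0mx ?dw ?addr0 //.
move: da; rewrite oppr_eq0 => /eqP da.
(* The vectors [a] and [b] need not be homogeneous; their parts of degrees [n] and [n - 1] are the
   ones that matter. *)
exists (graded_part 0 (cdeg X) n a).
  split; first exact/homog_graded/graded_part_graded.
  rewrite -(graded_partMr (r := n) (t := n + 1) _ _ _ (@cdiff_graded _ X)) // da.
  by apply: graded_part_id; apply: graded0.
exists (graded_part 0 (cdeg Y) (n - 1) b).
  exact/homog_graded/graded_part_graded.
rewrite -(graded_partMr (r := n - 1) (t := n) _ _ _ (@cdiff_graded _ Y)) ?subrK //.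
rewrite -(graded_partMr (r := n) (t := n) _ _ _ (@cmat_graded _ _ _ f)) ?addr0 //.
have /homog_graded/graded_part_id <- := hw.
by rewrite [in LHS]ew graded_partD addrC addKr.
Qed.

End Exactness.

(** * Tensor products of complexes over a field *)

Section TensorExactness.
Variable k : fieldType.
Variables X Y : bcomplex k.

Lemma sign_mx_sq : sign_mx X *m sign_mx X = 1%:M.
Proof.
rewrite mulmx_diag -diag_const_mx; congr diag_mx; apply/rowP => i.
by rewrite !mxE -expr2 sqrr_sign.
Qed.

Lemma sign_mx_anticomm (h : 'M_(cdim X)) :
  graded (cdeg X) (cdeg X) (- 1) h ->
  h *m sign_mx X = - (sign_mx X *m h).
Proof.
move=> hh; apply/matrixP => i j; rewrite mul_mx_diag mul_diag_mx !mxE.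
have [->|/hh ->] := eqVneq (h i j) 0; first by rewrite mul0r mulr0 oppr0.
(* The exponent in [sign_mx] is an absolute value: lowering the degree by one changes it by one,
   upwards or downwards, so the sign flips in both cases. *)
have [->|->] : `|(cdeg X 0 i + - 1)%R|%N = `|cdeg X 0%R i|%N.+1 \/
               `|cdeg X 0%R i|%N = `|(cdeg X 0 i + - 1)%R|%N.+1 by lia.
  by rewrite exprS mulN1r mulrN mulrC.
by rewrite exprS mulN1r mulNr opprK mulrC.
Qed.

Lemma tensmxDl m n p q (A B : 'M[k]_(m, n)) (C : 'M_(p, q)) :
  (A + B) *t C = A *t C + B *t C.
Proof. by apply/matrixP => i j; rewrite !mxE mulrDl. Qed.

Lemma tensmxDr m n p q (A : 'M[k]_(m, n)) (B C : 'M_(p, q)) :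
  A *t (B + C) = A *t B + A *t C.
Proof. by apply/matrixP => i j; rewrite !mxE mulrDr. Qed.

Lemma tensmxNl m n p q (A : 'M[k]_(m, n)) (C : 'M_(p, q)) :
  (- A) *t C = - (A *t C).
Proof. by apply/matrixP => i j; rewrite !mxE mulNr. Qed.

Lemma tens1mx1 m n : (1%:M : 'M[k]_m) *t (1%:M : 'M_n) = 1%:M.
Proof.
apply/matrixP => i j; case: (mxtens_indexP i) => a b; case: (mxtens_indexP j) => c d.
rewrite tensmxE !mxE -natrM mulnb (inj_eq (can_inj (@mxtens_indexK _ _))).
by rewrite xpair_eqE.
Qed.

(** If [h] contracts [X], then [h *t 1] contracts the product: the cross terms cancel because [h]
    anticommutes with the sign matrix. *)
Lemma exact_tensl : exact X -> exact (ctens X Y).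
Proof.
move=> /exactP[h hh eh].
apply: (exact_of_splitting (X := ctens X Y) (p := h *t 1%:M) (q := h *t 1%:M)).
rewrite /= /ctens_diff mulmxDl mulmxDr !tensmx_mul !mul1mx !mulmx1.
rewrite sign_mx_anticomm // tensmxNl addrACA -tensmxDl eh tens1mx1.
by rewrite subrr addr0.
Qed.

(** The contraction is [sign_mx X *t h]: its sign squares to the identity against the sign in the
    differential, and anticommutes with [cdiff X]. *)
Lemma exact_tensr : exact Y -> exact (ctens X Y).
Proof.
move=> /exactP[h hh eh].
apply: (exact_of_splitting (X := ctens X Y)
  (p := sign_mx X *t h) (q := sign_mx X *t h)).
rewrite /= /ctens_diff mulmxDl mulmxDr !tensmx_mul !mul1mx !mulmx1.
rewrite sign_cdiff tensmxNl addrACA addNr add0r sign_mx_sq -tensmxDr eh.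
exact: tens1mx1.
Qed.

Lemma mulmx_col m n p (A : 'M[k]_(m, n)) (B : 'M_(n, p)) j :
  A *m col j B = col j (A *m B).
Proof. by rewrite !colE mulmxA. Qed.

(** A cocycle outside the row space of the differential is detected by some column of its cokernel
    matrix; rescaling makes the value 1. *)
Lemma not_exact_functional (Z : bcomplex k) : ~ exact Z ->
  exists (v : 'rV_(cdim Z)) (phi : 'cV_(cdim Z)),
    [/\ v *m cdiff Z = 0, cdiff Z *m phi = 0 & v *m phi = 1%:M].
Proof.
move=> /existsNP[v /not_implyP[dv nb]].
have nz : v *m cokermx (cdiff Z) != 0.
  by apply: contra_notN nb => /eqP h; apply/submxP; rewrite submxE h.
have [j nj] : exists j, (v *m cokermx (cdiff Z)) 0 j != 0.
  apply/existsP; apply: contraNT nz => /existsPn h; apply/eqP/rowP => j.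
  by rewrite [RHS]mxE; apply/eqP; rewrite -[_ == _]negbK h.
exists v, (((v *m cokermx (cdiff Z)) 0 j)^-1 *: col j (cokermx (cdiff Z))).
split=> //.
  by rewrite -scalemxAr mulmx_col mulmx_coker col0 scaler0.
rewrite -scalemxAr mulmx_col; apply/matrixP => a b.
by rewrite !ord1 mxE [col _ _ _ _]mxE mulVf // mxE eqxx.
Qed.

(** The vanishing part of the Künneth theorem. If neither factor is exact, the tensor product of two
    detected cocycles is a cocycle on which the product functional takes the value 1, while that
    functional kills all boundaries. *)
Lemma exact_tens : exact (ctens X Y) <-> exact X \/ exact Y.
Proof.
split; last by case; [apply: exact_tensl|apply: exact_tensr].
move=> ex; apply: contrapT => /not_orP[].
move=> /not_exact_functional[v [phi [dv dphi e]]].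
move=> /not_exact_functional[w [psi [dw dpsi e']]].
have dvw : (v *t w) *m ctens_diff X Y = 0.
  by rewrite mulmxDr !tensmx_mul dv dw tens0mx tensmx0 addr0.
have [u eu] := ex (v *t w) dvw.
suff : (v *t w) *m (phi *t psi) = 0.
  rewrite tensmx_mul e e' tens1mx1 => /matrixP/(_ 0 0)/eqP.
  by rewrite !mxE eqxx oner_eq0.
(* The Kronecker product of row vectors has [1 * 1] rows; the ascription restates [eu] with that
   dimension. *)
have -> : v *t w = (u : 'M_(1 * 1, _)) *m ctens_diff X Y by [].
rewrite -mulmxA mulmxDl !tensmx_mul dphi dpsi tens0mx tensmx0.
by rewrite addr0 mulmx0.
Qed.

End TensorExactness.

(** * Exactness as an invariant of the derived category *)

Section DerivedCategory.
Variable k : fieldType.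
Implicit Types X Y Z W : bcomplex k.

Lemma coboundaryD X n v w :
  coboundary n v -> coboundary n w -> @coboundary k X n (v + w).
Proof.
move=> [u hu ->] [t ht ->]; exists (u + t); first exact: homogD.
by rewrite mulmxDl.
Qed.

Lemma coboundaryN X n v : coboundary n v -> @coboundary k X n (- v).
Proof.
move=> [u /homog_graded hu ->]; exists (- u); last by rewrite mulNmx.
exact/homog_graded/gradedN.
Qed.

Lemma coboundary0 X n : @coboundary k X n 0.
Proof.
exists 0; last by rewrite mul0mx.
by apply/homog_graded; apply: graded0.
Qed.

Lemma coboundary_map X Y (f : cmap X Y) n v :
  coboundary n v -> coboundary n (v *m f).
Proof.
move=> [u hu ->]; exists (u *m f); last by rewrite -!mulmxA cmat_comm.
by rewrite -[n - 1]addr0; apply: homogM hu; apply: cmat_graded.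
Qed.

Lemma cocycle_map X Y (f : cmap X Y) n v : cocycle n v -> cocycle n (v *m f).
Proof.
move=> [hv dv]; split; last by rewrite -mulmxA cmat_comm mulmxA dv mul0mx.
by rewrite -[n]addr0; apply: homogM hv; apply: cmat_graded.
Qed.

Definition cohomologous X n (v w : 'rV[k]_(cdim X)) : Prop :=
  [/\ cocycle n v, cocycle n w & @coboundary k X n (w - v)].

Lemma cohomologous_refl X n v : cocycle n v -> @cohomologous X n v v.
Proof. by split=> //; rewrite subrr; apply: coboundary0. Qed.

Lemma cohomologous_sym X n v w :
  @cohomologous X n v w -> @cohomologous X n w v.
Proof. by case=> hv hw /coboundaryN; rewrite opprB; split. Qed.

Lemma cohomologous_trans X n v w u :
  @cohomologous X n v w -> @cohomologous X n w u -> @cohomologous X n v u.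
Proof.
case=> hv hw b1 [_ hu b2]; split=> //.
by have := coboundaryD b2 b1; rewrite addrA subrK.
Qed.

Lemma cohomologous_map X Y (f : cmap X Y) n v w :
  @cohomologous X n v w -> @cohomologous Y n (v *m f) (w *m f).
Proof.
by case=> hv hw /(@coboundary_map _ _ f); rewrite mulmxBl; split=> //; apply: cocycle_map.
Qed.

Lemma quasi_iso_inj X Y (f : cmap X Y) (qf : quasi_iso f) n v w :
  cocycle n v -> cocycle n w ->
  @cohomologous Y n (v *m f) (w *m f) -> @cohomologous X n v w.
Proof.
move=> hv hw [_ _]; rewrite -mulmxBl => b; split=> //.
apply: (qf n).1 b; case: hv hw => hv dv [hw dw].
by split; [apply: homogB|rewrite mulmxBl dv dw subrr].
Qed.

(** A formal composite acts on cohomology as a relation, since the inverse of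
    a quasi-isomorphism need not be a chain map. *)
Fixpoint coh_rel n X Y (a : dhom X Y) : 'rV[k]_(cdim X) -> 'rV[k]_(cdim Y) -> Prop :=
  match a with
  | dmap X Y f => fun v w => cocycle n v /\ @cohomologous Y n (v *m f) w
  | dinv X Y f _ => fun w v => cocycle n v /\ @cohomologous Y n (v *m f) w
  | dcomp _ _ _ a b => fun v w => exists2 u, coh_rel n a v u & coh_rel n b u w
  end.

Lemma coh_rel_cocycle n X Y (a : dhom X Y) v w :
  coh_rel n a v w -> cocycle n v /\ cocycle n w.
Proof.
elim: a v w => [{}X {}Y f|{}X {}Y f qf|{}X {}Y Z a IHa b IHb] v w /=.
- by case=> hv [].
- by case=> hw [].
- by case=> u /IHa[hv _] /IHb[].
Qed.

(** The relation thus depends only on cohomology classes, which is what the identity laws in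
    [coh_rel_deq] require. *)
Lemma coh_rel_cohomologous n X Y (a : dhom X Y) v v' w w' :
  cohomologous n v v' -> cohomologous n w w' ->
  coh_rel n a v w -> coh_rel n a v' w'.
Proof.
elim: a v v' w w' => [{}X {}Y f|{}X {}Y f qf|{}X {}Y Z a IHa b IHb] v v' w w' /=.
- move=> hv hw [_ h]; split; first by case: hv.
  apply: cohomologous_trans hw; apply: cohomologous_trans h.
  exact/cohomologous_map/cohomologous_sym.
- move=> hw hv [_ h]; split; first by case: hv.
  apply: cohomologous_trans hw; apply: cohomologous_trans h.
  exact/cohomologous_map/cohomologous_sym.
- move=> hv hw [u hu hu']; have [_ cu] := coh_rel_cocycle hu.
  exists u; first by apply: IHa hu => //; apply: cohomologous_refl.
  by apply: IHb hu' => //; apply: cohomologous_refl.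
Qed.

Lemma coh_rel_cid n X v w :
  coh_rel n (dmap (Defs.cid X)) v w <-> @cohomologous X n v w.
Proof. by rewrite /= mulmx1; split=> [[]|h] //; split=> //; case: h. Qed.

(** By induction on the generators of the congruence. The two inverse laws use the
    quasi-isomorphism: [dinv] after [dmap] needs injectivity on cohomology, [dmap] after [dinv]
    needs surjectivity. *)
Lemma coh_rel_deq n X Y (a b : dhom X Y) : deq a b ->
  forall v w, coh_rel n a v w <-> coh_rel n b v w.
Proof.
elim=> {X Y a b}.
- by [].
- by move=> X Y a b _ IH v w; rewrite IH.
- by move=> X Y a b c _ IH1 _ IH2 v w; rewrite IH1.
- move=> X Y Z a a' b b' _ IHa _ IHb v w /=.
  by split=> -[u /IHa hu /IHb hu']; exists u.
- move=> X Y Z T a b c v w /=; split.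
    by case=> u hu [t ht ht']; exists t => //; exists u.
  by case=> t [u hu ht] ht'; exists u => //; exists t.
- move=> X Y a v w; split=> [[u /coh_rel_cid hu ha]|ha].
    have [_ cw] := coh_rel_cocycle ha.
    apply: coh_rel_cohomologous ha; first exact: cohomologous_sym.
    exact: cohomologous_refl.
  have [cv _] := coh_rel_cocycle ha.
  by exists v => //; apply/coh_rel_cid/cohomologous_refl.
- move=> X Y a v w; split=> [[u ha /coh_rel_cid hu]|ha].
    have [cv _] := coh_rel_cocycle ha.
    by apply: coh_rel_cohomologous ha => //; apply: cohomologous_refl.
  have [_ cw] := coh_rel_cocycle ha.
  by exists w => //; apply/coh_rel_cid/cohomologous_refl.
- by move=> X Y f g e v w /=; rewrite e.
- move=> X Y Z f g v w /=; rewrite mulmxA; split.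
    case=> cv h; exists (v *m f); split=> //; last exact: cocycle_map.
    exact/cohomologous_refl/cocycle_map.
  case=> u [cv h] [cu h']; split=> //; apply: cohomologous_trans h'.
  exact: cohomologous_map.
- move=> X Y f qf v w; rewrite coh_rel_cid /=; split.
    case=> u [cv h] [cw h']; apply: (quasi_iso_inj qf) => //.
    exact/(cohomologous_trans h)/cohomologous_sym.
  move=> h; have [cv cw _] := h; exists (w *m f); split=> //.
    exact: cohomologous_map.
  exact/cohomologous_refl/cocycle_map.
- move=> X Y f qf v w; rewrite coh_rel_cid /=; split.
    case=> u [cu h] [_ h']; apply: cohomologous_trans h'.
    exact: cohomologous_sym.
  move=> h; have [cv cw _] := h; have [u cu bu] := (qf n).2 v cv.
  have hu : cohomologous n (u *m f) v by split=> //; apply: cocycle_map.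
  by exists u; split=> //; apply: cohomologous_trans h.
Qed.

(** The relation sends the zero class only to the zero class; for a formal inverse this is
    injectivity on cohomology. *)
Lemma coh_rel_coboundary n X Y (a : dhom X Y) v w :
  coh_rel n a v w -> coboundary n v -> coboundary n w.
Proof.
elim: a v w => [{}X {}Y f|{}X {}Y f qf|{}X {}Y Z a IHa b IHb] v w /=.
- move=> [_ [_ _ h]] /(@coboundary_map _ _ f) h'.
  by have := coboundaryD h h'; rewrite subrK.
- move=> [cw [_ _ h]] hv; apply: (qf n).1 => //.
  by have := coboundaryD hv (coboundaryN h); rewrite opprB addrC subrK.
- by case=> u /IHa h /IHb h' /h.
Qed.

Lemma isom_exact X Y : @isom (Db k) X Y -> exact X -> exact Y.
Proof.
move=> [a [b [_ ba]]] /exact_acyclic acX; apply/exact_acyclic => n w cw.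
(* Since [b] followed by [a] is the identity, [w] is related to itself through some cocycle [u] of
   the acyclic complex [X]. *)
have [_ h] := coh_rel_deq n ba w w.
have [|u ru ru'] := h; first exact/coh_rel_cid/cohomologous_refl.
apply: coh_rel_coboundary ru' _; apply: acX.
by have [_] := coh_rel_cocycle ru.
Qed.

(** * Isomorphisms and triangles in the derived category *)

Lemma isom_sym (K : mtcat) (x y : ob K) : isom x y -> isom y x.
Proof. by case=> f [g [h1 h2]]; exists g, f. Qed.

Lemma isom_refl X : @isom (Db k) X X.
Proof. by exists (dmap (Defs.cid X)), (dmap (Defs.cid X)); split; apply: deq_idl. Qed.

Lemma isom_trans X Y Z :
  @isom (Db k) X Y -> @isom (Db k) Y Z -> @isom (Db k) X Z.
Proof.
move=> [f [f' [e1 e2]]] [g [g' [e3 e4]]] /=.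
have cancel_mid A B C (p : dhom A B) (q : dhom B C) (q' : dhom C B) (p' : dhom B A) :
    deq (dcomp q q') (dmap (Defs.cid B)) -> deq (dcomp p p') (dmap (Defs.cid A)) ->
    deq (dcomp (dcomp p q) (dcomp q' p')) (dmap (Defs.cid A)).
  move=> eq ep; apply: deq_trans ep; apply: deq_trans (deq_assoc _ _ _) _.
  apply: deq_comp (deq_refl _); apply: deq_trans (deq_sym (deq_assoc _ _ _)) _.
  exact: deq_trans (deq_comp (deq_refl _) eq) (deq_idr _).
by exists (dcomp f g), (dcomp g' f'); split; apply: cancel_mid.
Qed.

Lemma quasi_iso_isom X Y (f : cmap X Y) : quasi_iso f -> @isom (Db k) X Y.
Proof.
move=> qf; exists (dmap f), (dinv qf).
by split; [apply: deq_invr|apply: deq_invl].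
Qed.

Fact zero_comm X Y : (0 : 'M_(cdim X, cdim Y)) *m cdiff Y = cdiff X *m 0.
Proof. by rewrite mul0mx mulmx0. Qed.

Definition czeromap X Y : cmap X Y := CMap (@graded0 k _ _ _ _ _) (zero_comm X Y).

(** Even the zero map is a quasi-isomorphism here, its cone being exact. *)
Lemma exact_isom X Y : exact X -> exact Y -> @isom (Db k) X Y.
Proof.
move=> exX exY; apply: (quasi_iso_isom (f := czeromap X Y)).
by apply: quasi_iso_of_cone; have [h _ _] := exact_cone (czeromap X Y); apply: h.
Qed.

Lemma ddist_exact X Y Z (u : dhom X Y) (v : dhom Y Z) (w : dhom Z (cshift X)) :
  ddist u v w ->
  [/\ exact X -> exact Y -> exact Z, exact Y -> exact Z -> exact X &
      exact X -> exact Z -> exact Y].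
Proof.
move=> [A [B [f [a [a' [b [b' [c [c' [[ea eb ec] _]]]]]]]]]].
have iA : @isom (Db k) X A by exists a, a'.
have iB : @isom (Db k) Y B by exists b, b'.
have iC : @isom (Db k) Z (cone f) by exists c, c'.
have exact_eq V W : @isom (Db k) V W -> exact V = exact W.
  by move=> i; apply/propext; split; apply: isom_exact => //; apply: isom_sym.
rewrite (exact_eq _ _ iA) (exact_eq _ _ iB) (exact_eq _ _ iC).
exact: exact_cone.
Qed.

Lemma ddist_cone X Y (f : cmap X Y) :
  ddist (dmap f) (dmap (cone_in f)) (dmap (cone_out f)).
Proof.
exists X, Y, f, (dmap (Defs.cid X)), (dmap (Defs.cid X)), (dmap (Defs.cid Y)),
  (dmap (Defs.cid Y)),
  (dmap (Defs.cid (cone f))), (dmap (Defs.cid (cone f))).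
have sid : deq (dshiftm (dmap (Defs.cid X))) (dmap (Defs.cid (cshift X))).
  exact: deq_ext.
by split; split; try (by split; apply: deq_idl);
  apply: deq_trans (deq_sym (deq_idl _));
  try apply: deq_idr; apply: deq_trans (deq_comp (deq_refl _) sid) (deq_idr _).
Qed.

Lemma exact_cone_cid X : exact (cone (Defs.cid X)).
Proof.
apply/exact_coneP => x y dx; rewrite mulmx1 => e.
exists y, 0; split; last by rewrite mulmx1 mul0mx addr0.
by apply/eqP; rewrite -addr_eq0 e.
Qed.

Lemma isom_cone_in X Y (f : cmap X Y) :
  exact X -> @isom (Db k) Y (cone f).
Proof.
move=> exX; apply: (quasi_iso_isom (f := cone_in f)); apply: quasi_iso_of_cone.
apply/exact_coneP => y v dy; rewrite -[v]hsubmxK cone_mul.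
set a := lsubmx v; set b := rsubmx v.
rewrite /= /cone_in_mat mul_mx_row mulmx0 mulmx1 add_row_mx add0r -row_mx0.
move=> /eq_row_mx[/eqP]; rewrite oppr_eq0 => /eqP/exX[u eu] ey.
(* As [a] is the boundary of [u], the boundary of [(-u, 0)] in the cone is [(a, - u f)]; subtracting
   it from [(a, b)] leaves a vector coming from [Y]. *)
exists (b + u *m f), (row_mx (- u) 0); split.
  apply/eqP; rewrite -addr_eq0 mulmxDl -mulmxA cmat_comm mulmxA -eu.
  by rewrite [X in y + X]addrC ey.
rewrite mul_mx_row mulmx0 mulmx1 -/(cdiff (cone f)) cone_mul add_row_mx.
by rewrite !mulNmx opprK -eu add0r mul0mx addr0 addrK.
Qed.

Lemma isom_cdsuml X Z : exact Z -> @isom (Db k) X (cdsum X Z).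
Proof.
move=> exZ.
have gr : graded (cdeg X) (cdeg (cdsum X Z)) 0
    (row_mx 1%:M 0 : 'M[k]_(cdim X, cdim (cdsum X Z))).
  move=> i j; rewrite -(splitK j); case: (split j) => {}j /=.
    by rewrite !row_mxEl => /graded1 ->.
  by rewrite row_mxEr mxE eqxx.
have cm : (row_mx 1%:M 0 : 'M[k]_(cdim X, cdim (cdsum X Z))) *m
    cdiff (cdsum X Z) = cdiff X *m row_mx 1%:M 0.
  by rewrite /= mul_row_block mul_mx_row !mulmx0 !mul0mx mul1mx mulmx1 !addr0.
apply: (quasi_iso_isom (f := CMap gr cm)); apply/quasi_iso_of_cone/exact_coneP.
move=> x v dx; rewrite -[v]hsubmxK /= mul_row_block mul_mx_row.
set a := lsubmx v; set b := rsubmx v.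
rewrite !mulmx0 mulmx1 addr0 add0r add_row_mx add0r -row_mx0.
move=> /eq_row_mx[ex /exZ[u ->]].
exists a, (row_mx 0 u); split; first by apply/eqP; rewrite -addr_eq0 ex.
rewrite mul_mx_row mulmx1 mulmx0 mul_row_block !mulmx0 mul0mx !add0r add_row_mx.
by rewrite addr0 add0r.
Qed.

Lemma isom_cdsumr X Z : exact Z -> @isom (Db k) X (cdsum Z X).
Proof.
move=> exZ.
have gr : graded (cdeg X) (cdeg (cdsum Z X)) 0
    (row_mx 0 1%:M : 'M[k]_(cdim X, cdim (cdsum Z X))).
  move=> i j; rewrite -(splitK j); case: (split j) => {}j /=.
    by rewrite row_mxEl mxE eqxx.
  by rewrite !row_mxEr => /graded1 ->.
have cm : (row_mx 0 1%:M : 'M[k]_(cdim X, cdim (cdsum Z X))) *m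
    cdiff (cdsum Z X) = cdiff X *m row_mx 0 1%:M.
  by rewrite /= mul_row_block mul_mx_row !mulmx0 !mul0mx mul1mx mulmx1 !add0r.
apply: (quasi_iso_isom (f := CMap gr cm)); apply/quasi_iso_of_cone/exact_coneP.
move=> x v dx; rewrite -[v]hsubmxK /= mul_row_block mul_mx_row.
set a := lsubmx v; set b := rsubmx v.
rewrite !mulmx0 mulmx1 addr0 add0r add_row_mx add0r -row_mx0.
move=> /eq_row_mx[/exZ[u ->] ex].
exists b, (row_mx u 0); split; first by apply/eqP; rewrite -addr_eq0 ex.
rewrite mul_mx_row mulmx1 mulmx0 mul_row_block !mulmx0 mul0mx !addr0 add_row_mx.
by rewrite addr0 add0r.
Qed.

(** The map is the identity matrix, cast along [cdim X = cdim X * 1], which is not a conversion. *)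
Lemma isom_ctens1 X : @isom (Db k) (ctens X (cunit k)) X.
Proof.
pose e := esym (muln1 (cdim X)).
(* Generalizing the dimension to a variable [n] lets the equality be eliminated, after which the
   casts disappear. *)
have castl n (en : cdim X = n) :
    castmx (en, erefl) (1%:M : 'M[k]_(cdim X)) *m cdiff X =
    castmx (en, en) (cdiff X) *m castmx (en, erefl) 1%:M.
  by case: n / en; rewrite /= !castmx_id mul1mx mulmx1.
have castK n (en : cdim X = n) :
    castmx (en, erefl) (1%:M : 'M[k]_(cdim X)) *m castmx (erefl, en) 1%:M = 1%:M /\
    castmx (erefl, en) (1%:M : 'M[k]_(cdim X)) *m castmx (en, erefl) 1%:M = 1%:M.
  by case: n / en; rewrite /= !castmx_id mul1mx.
pose A : 'M[k]_(cdim (ctens X (cunit k)), cdim X) := castmx (e, erefl) 1%:M.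
have grA : graded (cdeg (ctens X (cunit k))) (cdeg X) 0 A.
  move=> i j; rewrite castmxE mxE.
  case: (boolP (cast_ord _ i == _)) => [/eqP ij _|_]; last by rewrite eqxx.
  rewrite !mxE !addr0; congr (cdeg X _ _); apply/val_inj.
  by have /(congr1 val) /= := ij; rewrite divn1 => ->.
have cmA : A *m cdiff X = cdiff (ctens X (cunit k)) *m A.
  by rewrite /= /ctens_diff tensmx0 addr0 tens_mx_scalar scale1r; apply: castl.
have ex : exact (cone (CMap grA cmA)).
  apply/exact_coneP => x y dx /= ey; have [AK KA] := castK _ e.
  exists (y *m castmx (erefl, e) 1%:M), 0.
  rewrite mul0mx addr0 -!mulmxA KA mulmx1; split=> //.
  apply/eqP; rewrite -addr_eq0; apply/eqP.
  have inj (z : 'rV_(cdim (ctens X (cunit k)))) : z *m A = 0 -> z = 0.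
    by move=> /(congr1 (mulmx^~ (castmx (erefl, e) 1%:M)));
      rewrite -mulmxA AK mulmx1 mul0mx.
  by apply: inj; rewrite mulmxDl -!mulmxA -cmA [X in y *m X]mulmxA KA mul1mx.
exact: quasi_iso_isom (quasi_iso_of_cone ex).
Qed.

End DerivedCategory.

(** * The crossed product *)

Section Crossed.
Variable k : fieldType.
Local Notation K := (Db2C2 k).
Implicit Types (x y z : ob K) (g h : 'Z_2) (b : bool).

(** The boolean names the summand of [Db2], so that the swap action becomes [~~]. *)
Definition coord x g b : bcomplex k := if b then (x g).1 else (x g).2.

Definition of_coords (X : 'Z_2 -> bool -> bcomplex k) : ob K :=
  fun g => (X g true, X g false).

Lemma coord_of_coords X g b : coord (of_coords X) g b = X g b.
Proof. by case: b. Qed.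

Lemma Z2P g : g = 0 \/ g = 1.
Proof. by case: g => [[|[|//]] i]; [left|right]; apply: val_inj. Qed.

(** The generator swaps summands and is its own inverse, whence [1 + h] and [~~ b]. The final
    [czero] is the initial value of the iterated sum, neutral only up to isomorphism. *)
Lemma coord_tens x y h b :
  coord (tens x y) h b =
  cdsum (ctens (coord x 0 b) (coord y h b))
    (cdsum (ctens (coord x 1 b) (coord y (1 + h) (~~ b))) (czero k)).
Proof.
have e0 : (ord0 : 'Z_2) = 1%g by apply: val_inj.
have e1 : (lift ord0 ord0 : 'Z_2) = 1 by apply: val_inj.
have e2 : ((1%R : 'Z_2)^-1 * h)%g = 1 + h.
  by have [->|->] := Z2P h; apply: val_inj.
rewrite /coord /= !big_ord_recl big_ord0 /= e1 e0 e2 invg1 mul1g.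
by rewrite /swap_act eqxx; case: b.
Qed.

Lemma coord_isom x y :
  isom x y <-> forall g b, @isom (Db k) (coord x g b) (coord y g b).
Proof.
split=> [[f [f' [e e']]] g b|i].
  by case: b; [exists (f g).1, (f' g).1|exists (f g).2, (f' g).2];
    split; case: (e g); case: (e' g).
(* An isomorphism is a whole family of morphisms, so choice turns the separate existence statements
   into data. *)
have F g : {f : Defs.hom (x g) (y g) & {f' : Defs.hom (y g) (x g) |
    heq (Defs.comp f f') (idm (x g)) /\ heq (Defs.comp f' f) (idm (y g))}}.
  have [f1 /boolp.cid[f1' [e1 e1']]] := boolp.cid (i g true).
  have [f2 /boolp.cid[f2' [e2 e2']]] := boolp.cid (i g false).
  by exists (f1, f2), (f1', f2').
exists (fun g => projT1 (F g)), (fun g => sval (projT2 (F g))).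
by split=> g; have [] := svalP (projT2 (F g)).
Qed.

(** * The prime ideal of vanishing objects *)

Definition vanishing x : Prop := forall g b, exact (coord x g b).

Lemma vanishing_tens x y : vanishing (tens x y) <->
  forall g b, (exact (coord x 0 b) \/ exact (coord y g b)) /\
    (exact (coord x 1 b) \/ exact (coord y (1 + g) (~~ b))).
Proof.
split=> v g b; have := v g b; rewrite coord_tens.
  by move=> /exact_cdsum[/exact_tens ? /exact_cdsum[/exact_tens ?]].
move=> [? ?]; apply/exact_cdsum; split; first exact/exact_tens.
by apply/exact_cdsum; split; [apply/exact_tens|apply: exact_czero].
Qed.

Lemma vanishing_ideal : thick_ideal vanishing.
Proof.
split.
- split.
  + by move=> g b; case: b; apply: exact_czero.
  + by move=> x y /coord_isom i v g b; apply: isom_exact (i g b) (v g b).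
  + have e x g b : coord (shift x) g b = cshift (coord x g b) by case: b.
    by move=> x; split=> v g b; have := v g b; rewrite e exact_cshift.
  + move=> x y z f f' f'' d.
    have e g b : [/\ exact (coord x g b) -> exact (coord y g b) -> exact (coord z g b),
       exact (coord y g b) -> exact (coord z g b) -> exact (coord x g b) &
       exact (coord x g b) -> exact (coord z g b) -> exact (coord y g b)].
      by have [d1 d2] := d g; case: b; [apply: ddist_exact d1|apply: ddist_exact d2].
    by split=> v v' g b; have [h1 h2 h3] := e g b; auto.
  + have e x y g b : coord (oplus x y) g b = cdsum (coord x g b) (coord y g b).
      by case: b.
    by move=> x y v; split=> g b; have := v g b; rewrite e => /exact_cdsum[].
- by move=> x y v; apply/vanishing_tens => g b; split; right.
- by move=> x y v; apply/vanishing_tens => g b; split; left.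
Qed.

Definition unit_on (t : 'Z_2 -> bool -> bool) : ob K :=
  of_coords (fun g b => if t g b then cunit k else czero k).

Lemma vanishing_prime x y :
  (forall z, vanishing (tens (tens x z) y)) -> vanishing x \/ vanishing y.
Proof.
move=> v; apply: contrapT => /not_orP[] /existsNP[g /existsNP[i nx]].
move=> /existsNP[h /existsNP[j ny]].
(* With units in all four places, [z] spreads [x]: each coordinate [(l, i)] of [x * z] contains both
   [x 0 i] and [x 1 i], one of which is not exact. *)
pose z := unit_on (fun _ _ => true).
have nxz l : ~ exact (coord (tens x z) l i).
  rewrite coord_tens !coord_of_coords => /exact_cdsum[/exact_tens e0].
  move=> /exact_cdsum[/exact_tens e1 _].
  by have [gE|gE] := Z2P g; move: nx; rewrite gE; [case: e0|case: e1] => // /exact_cunit.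
(* The non-exact coordinate [(h, j)] of [y] is met through degree 0 of [x * z] if [j = i], and
   otherwise through degree 1, whose swap carries [j] to [i]. *)
have [ji|ji] := eqVneq j i.
  by have [[/nxz|ey] // _] := (vanishing_tens _ _).1 (v z) h i; case: ny; rewrite ji.
have [_ [/nxz|ey] //] := (vanishing_tens _ _).1 (v z) (1 + h) i.
case: ny; move: ey.
have -> : ~~ i = j by case: (i) (j) ji => [] [].
suff -> : 1 + (1 + h) = h by [].
by have [->|->] := Z2P h; apply: val_inj.
Qed.

Lemma not_vanishing_one : ~ vanishing Defs.one.
Proof. by move=> /(_ 0 true); apply: exact_cunit. Qed.

(** Each set is empty or everything, hence closed. Sums, shifts and triangles use thickness, and the
    tensor axiom combines the ideal property with [vanishing_prime]. *)
Lemma vanishing_support_datum :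
  support_datum (fun x => [set _ : bool | ~ vanishing x]%classic).
Proof.
have idV := vanishing_ideal; have thV := ideal_thick idV.
have sE x (v : vanishing x) : [set _ : bool | ~ vanishing x]%classic = set0%classic.
  by apply/seteqP; split=> // ? /(_ v).
split.
- move=> x; have [v|nv] := pselect (vanishing x); first by rewrite sE //; apply: closed0.
  have -> : [set _ : bool | ~ vanishing x]%classic = setT by apply/seteqP; split.
  exact: closedT.
- by apply: sE; apply: thick0 thV.
- by apply/seteqP; split=> // ? _; apply: not_vanishing_one.
- move=> x y; apply/seteqP; split=> t /=.
    move=> nv; apply: contrapT => /not_orP[/contrapT vx /contrapT vy]; apply: nv.
    move=> g i; have : exact (cdsum (coord x g i) (coord y g i)).
      by apply/exact_cdsum; split.
    by case: i.
  by case=> nv /(thick_summand thV)[? ?]; apply: nv.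
- by move=> x; apply/seteqP; split=> t /= nv v; apply: nv; apply/(thick_shift thV).
- move=> x y z f g h d t /= nx; apply: contrapT.
  move=> /not_orP[/contrapT vy /contrapT vz]; apply: nx.
  by have [_ h2 _] := thick_dist thV d; apply: h2.
- move=> x y; apply/seteqP; split=> t /=.
    move=> [z _ nv]; split=> v; apply: nv.
      exact/(ideal_tensr idV)/(ideal_tensr idV).
    exact/(ideal_tensl idV).
  move=> [nx ny]; apply: contrapT => h.
  have [] // := @vanishing_prime x y => z.
  by apply: contrapT => nv; apply: h; exists z.
Qed.

(** * Absence of completely prime ideals *)

Lemma coord_tens_unit_on x t g b :
  ~~ (t g b && t (1 + g) (~~ b)) ->
  @isom (Db k) (coord (tens x (unit_on t)) g b)
    (if t g b then coord x 0 b else if t (1 + g) (~~ b) then coord x 1 b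
     else czero k).
Proof.
rewrite coord_tens !coord_of_coords.
(* The hypothesis leaves at most one summand with a unit factor; the other summands are exact and
   drop out. *)
have ex0 X : exact (ctens X (czero k)) by apply/exact_tensr/exact_czero.
case: (t g b) => /= [/negPf ->|_].
  apply: isom_trans (isom_ctens1 _); apply/isom_sym/isom_cdsuml.
  by apply/exact_cdsum; split=> //; apply: exact_czero.
case: (t _ _).
  apply: isom_trans (isom_ctens1 _).
  apply: isom_trans (isom_sym (isom_cdsumr _ (ex0 _))) _.
  exact/isom_sym/isom_cdsuml/exact_czero.
apply: exact_isom; last exact: exact_czero.
apply/exact_cdsum; split=> //.
by apply/exact_cdsum; split=> //; apply: exact_czero.
Qed.

Definition restrict (s : 'Z_2 -> bool -> bool) x : ob K :=
  of_coords (fun g b => if s g b then coord x g b else czero k).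

Definition restrict_incl (t : bool) (X : bcomplex k) :
    cmap (if t then X else czero k) X :=
  if t return cmap (if t then X else czero k) X then Defs.cid X else czeromap _ X.

(** The cone of the inclusion of one piece is isomorphic to the complementary piece, coordinate by
    coordinate, so the cone triangle has two vertices in [P]. *)
Lemma thick_restrict P (s : 'Z_2 -> bool -> bool) x : thick P ->
  P (restrict s x) -> P (restrict (fun g b => ~~ s g b) x) -> P x.
Proof.
move=> thP Ps Pn.
pose m g b := restrict_incl (s g b) (coord x g b).
pose C : ob K := of_coords (fun g b => cone (m g b)).
pose u : Defs.hom (restrict s x) x := fun g => (dmap (m g true), dmap (m g false)).
pose v : Defs.hom x C :=
  fun g => (dmap (cone_in (m g true)), dmap (cone_in (m g false))).
pose w : Defs.hom C (shift (restrict s x)) :=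
  fun g => (dmap (cone_out (m g true)), dmap (cone_out (m g false))).
have d : dist u v w by move=> g; split; apply: ddist_cone.
have [_ _ h] := thick_dist thP d; apply: h => //.
apply: (thick_isom thP) Pn; apply/coord_isom => g b.
rewrite !coord_of_coords /m /restrict_incl.
case: (s g b) => /=; last exact/isom_cone_in/exact_czero.
exact/exact_isom/exact_cone_cid/exact_czero.
Qed.

Lemma not_completely_prime (P : set (ob K)) : ~ completely_prime_ideal P.
Proof.
move=> [[idP [x nPx]] cp]; apply: nPx; have thP := ideal_thick idP.
(* The group is additive, so [1] is the generator: [E] is [box (1, 0) 1] and [G] is [box (1, 1) 1].
   In [E * E] the swap makes [(1, 0)] meet [(0, 1)]. *)
pose E := unit_on (fun g b => (g == 1) && b).
pose G := unit_on (fun g _ => g == 1).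
have PE : P E.
  suff : P (tens E E) by move=> /cp[].
  apply: (thick_isom thP) (thick0 thP); apply/coord_isom => g b.
  apply: isom_trans (isom_sym (coord_tens_unit_on _ _)); last by case: b; rewrite ?andbF.
  by rewrite !coord_of_coords; have [->|->] := Z2P g; case: b; apply: isom_refl.
(* The product [E * G] is [(1, 0)] in degree [1 + 1 = 0]; below, [G * E] gives [(0, 1)] there, as
   [G] swaps what stands to its right. *)
pose E1 := unit_on (fun g b => (g == 0) && b).
have PE1 : P E1.
  apply: (thick_isom thP) (ideal_tensr idP G PE); apply/coord_isom => g b.
  apply: isom_trans (coord_tens_unit_on _ _) _; first by have [->|->] := Z2P g.
  by rewrite !coord_of_coords; have [->|->] := Z2P g; case: b; apply: isom_refl.
pose E2 := unit_on (fun g b => (g == 0) && ~~ b).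
have PE2 : P E2.
  apply: (thick_isom thP) (ideal_tensl idP G PE); apply/coord_isom => g b.
  apply: isom_trans (coord_tens_unit_on _ _) _; first by case: b; rewrite ?andbF.
  by rewrite !coord_of_coords; have [->|->] := Z2P g; case: b; apply: isom_refl.
(* In [x * E1] the degree 1 part of [x] acts on [E1] by the swap: the first summand survives in
   degree 0 and the second in degree 1. *)
apply: (thick_restrict (s := fun g b => (g == 0) == b) thP).
  apply: (thick_isom thP) (ideal_tensl idP x PE1); apply/coord_isom => g b.
  apply: isom_trans (coord_tens_unit_on _ _) _; first by case: b; rewrite ?andbF.
  by rewrite !coord_of_coords; have [->|->] := Z2P g; case: b; apply: isom_refl.
apply: (thick_isom thP) (ideal_tensl idP x PE2); apply/coord_isom => g b.
apply: isom_trans (coord_tens_unit_on _ _) _; first by case: b; rewrite ?andbF.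
by rewrite !coord_of_coords; have [->|->] := Z2P g; case: b; apply: isom_refl.
Qed.

Lemma vanishing_incl (a : ob (Db2 k)) :
  vanishing (@incl k a) <-> exact a.1 /\ exact a.2.
Proof.
split=> [v|[v1 v2] g b]; first by split; [apply: (v 0 true)|apply: (v 0 false)].
by have [->|->] := Z2P g; case: b => //; apply: exact_czero.
Qed.

End Crossed.

(** * Failure of primes and supports to restrict along the inclusion *)

Local Open Scope classical_set_scope.

Theorem theoremA (k : fieldType) :
  (~ exists P : set (ob (Db2C2 k)), completely_prime_ideal P)
  /\ (exists Q : set (ob (Db2C2 k)),
        Spc (Db2C2 k) Q /\ ~ Spc (Db2 k) (@incl k @^-1` Q))
  /\ (exists (Y : topologicalType) (sigma : ob (Db2C2 k) -> set Y),
        support_datum sigma /\ ~ support_datum (sigma \o @incl k)).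
Proof.
pose a : ob (Db2 k) := (cunit k, czero k).
pose b : ob (Db2 k) := (czero k, cunit k).
have va : ~ vanishing (@incl k a).
  by move=> /vanishing_incl[] /exact_cunit.
have vb : ~ vanishing (@incl k b).
  by move=> /vanishing_incl[_ /exact_cunit].
have vab z : vanishing (@incl k (tens (tens a z) b)).
  apply/vanishing_incl; split; apply/exact_tens; first by right; apply: exact_czero.
  by left; apply/exact_tens; left; apply: exact_czero.
split; first by case=> P; apply: not_completely_prime.
split.
  exists (@vanishing k); split.
    split; last exact: vanishing_prime.
    by split; [apply: vanishing_ideal|exists Defs.one]; apply: not_vanishing_one.
  by move=> [_ /(_ a b vab)[]].
(* The supports of [a] and [b] are the whole space, so [true] lies in both, but every [a * z * b]
   has empty support. *)
exists bool, (fun x => [set _ | ~ vanishing x]); split; last first.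
  move=> /supp_tens/(_ a b) /seteqP[_ /(_ true)[]]; first by split.
  by move=> z _ /(_ (vab z)).
exact: vanishing_support_datum.
Qed.
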